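(* Let $K$ be a field, let $m\ge5$ be an integer, and let $$(a_1,\ldots,a_m)=(5m,\,4m,\,4m-1,\,\ldots,\,3m+4,\,m,\,0),$$ that is, $a_1=5m$, $a_i=4m-(i-2)$ for $2\le i\le m-2$, $a_{m-1}=m$ and $a_m=0$. Let $I\subset K[x,y]$ be the symmetric ideal generated by the monomials $x^{a_i}y^{a_{m-i+1}}$, $i=1,\ldots,m$. Then $\operatorname{depth}F(I)=0$.
   Context: With $\mathfrak m=(x,y)\subset K[x,y]$, the fiber cone of $I$ is the standard graded $K$-algebra $F(I)=\bigoplus_{k\ge0}I^k/\mathfrak mI^k$; its depth is taken with respect to its graded maximal ideal $\bigoplus_{k\ge1}I^k/\mathfrak mI^k$. A symmetric ideal is a monomial ideal minimally generated by monomials $x^{a_i}y^{b_i}$ ($i=1,\ldots,m$) with $a_1>\cdots>a_m=0$, $0=b_1<\cdots<b_m$ and $b_i=a_{m-i+1}$ for all $i$. *)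

(* Defs.v *)
From HB Require Import structures.
From mathcomp Require Import all_boot all_order all_algebra.
From mathcomp Require Import boolp.
From mathcomp Require Import mpoly.

Set Implicit Arguments.
Unset Strict Implicit.
Unset Printing Implicit Defensive.

Import GRing.Theory.
Local Open Scope ring_scope.

Section Ideals.
Variable R : comNzRingType.
Implicit Types (I J : R -> Prop) (s : seq R) (x y : R).

Definition ideal_gen s x : Prop :=
  exists c : 'I_(size s) -> R, x = \sum_(i < size s) c i * s`_i.

Definition ideal_mul I J x : Prop :=
  exists2 u : seq (R * R), (forall ab, ab \in u -> I ab.1 /\ J ab.2)
    & x = \sum_(ab <- u) ab.1 * ab.2.

Fixpoint ideal_pow I (k : nat) : R -> Prop :=
  if k is j.+1 then ideal_mul I (ideal_pow I j) else fun=> True.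

Definition regular_sequence s : Prop :=
  (forall i, (i < size s)%N -> forall x,
     ideal_gen (take i s) (s`_i * x) -> ideal_gen (take i s) x)
  /\ ~ ideal_gen s 1.

(* The depth (grade) of R with respect to the ideal J is d: the maximal length
   of an R-regular sequence contained in J. *)
Definition has_depth J (d : nat) : Prop :=
  (exists s, [/\ regular_sequence s, forall x, x \in s -> J x & size s = d])
  /\ (forall s, regular_sequence s -> (forall x, x \in s -> J x) ->
        (size s <= d)%N).

Lemma ideal_mul0 I J : ideal_mul I J 0.
Proof. by exists [::] => //; rewrite big_nil. Qed.

Lemma ideal_mulD I J x y :
  ideal_mul I J x -> ideal_mul I J y -> ideal_mul I J (x + y).
Proof.
move=> [u hu ->] [v hv ->]; exists (u ++ v); last by rewrite big_cat.
by move=> ab; rewrite mem_cat => /orP[/hu|/hv].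
Qed.

Lemma ideal_mulZ I J r x : (forall a b, J b -> J (a * b)) ->
  ideal_mul I J x -> ideal_mul I J (r * x).
Proof.
move=> hJ [u hu ->]; exists [seq (ab.1, r * ab.2) | ab <- u].
  by move=> ab /mapP[cd /hu[h1 h2] ->] /=; split=> //; apply: hJ.
by rewrite big_map mulr_sumr; apply: eq_bigr => ab _; rewrite /= mulrCA.
Qed.

Lemma ideal_powZ I k r x : ideal_pow I k x -> ideal_pow I k (r * x).
Proof. by elim: k r x => // k IHk r x; apply: ideal_mulZ. Qed.

Lemma ideal_pow0 I k : ideal_pow I k 0.
Proof. by case: k => // k; apply: ideal_mul0. Qed.

Lemma ideal_powD I k x y :
  ideal_pow I k x -> ideal_pow I k y -> ideal_pow I k (x + y).
Proof. by case: k => // k; apply: ideal_mulD. Qed.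

Lemma ideal_powM I i j x y :
  ideal_pow I i x -> ideal_pow I j y -> ideal_pow I (i + j) (x * y).
Proof.
elim: i x => [|i IHi] x; first by move=> _; apply: ideal_powZ.
move=> [u hu ->] hy; exists [seq (ab.1, ab.2 * y) | ab <- u].
  by move=> ab /mapP[cd /hu[h1 h2] ->] /=; split=> //; apply: IHi.
by rewrite big_map mulr_suml; apply: eq_bigr => ab _; rewrite /= mulrA.
Qed.

Lemma ideal_mul_powM I J i j x y : ideal_pow I i x ->
  ideal_mul J (ideal_pow I j) y -> ideal_mul J (ideal_pow I (i + j)) (x * y).
Proof.
move=> hx [u hu ->]; exists [seq (ab.1, x * ab.2) | ab <- u].
  by move=> ab /mapP[cd /hu[h1 h2] ->] /=; split=> //; apply: ideal_powM.
by rewrite big_map mulr_sumr; apply: eq_bigr => ab _; rewrite /= mulrCA.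
Qed.

End Ideals.

Section FiberCone.
Variable K : fieldType.
Local Notation S := {mpoly K[2]}.
Local Notation "'x" := ('X_(ord0 : 'I_2) : S).
Local Notation "'y" := ('X_(ord_max : 'I_2) : S).

Definition max_ideal : S -> Prop := ideal_gen [:: 'x; 'y].

Lemma max_ideal_coef0 (p : S) : max_ideal p -> p@_0%MM = 0.
Proof.
have X0 i : ('X_i : S)@_0%MM = 0.
  by rewrite mcoeffX; case: eqP => // /mnmP/(_ i); rewrite mnm1E eqxx mnm0E.
move=> [c ->]; rewrite 2!big_ord_recl big_ord0 addr0 /=.
rewrite mcoeffD; apply/eqP.
by rewrite -![_@_0%MM]/(mcoeff 0%MM _)
  !(rmorphM (mcoeff 0%MM)) /= !X0 !mulr0 addr0.
Qed.

Variable I : S -> Prop.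

(* The Rees algebra, the sum of the I^k t^k, inside S[t]. *)
Definition rees_pred : {pred {poly S}} :=
  fun p => `[< forall k, ideal_pow I k p`_k >].

Lemma rees_subring_closed : subring_closed rees_pred.
Proof.
split.
- apply/asboolP => k; rewrite coef1; case: k => [|k] //=.
  exact: (ideal_pow0 I k.+1).
- move=> p q /asboolP hp /asboolP hq; apply/asboolP => k.
  by rewrite coefB -mulN1r; apply: ideal_powD (hp k) (ideal_powZ _ (hq k)).
- move=> p q /asboolP hp /asboolP hq; apply/asboolP => k; rewrite coefM.
  apply: (big_ind (ideal_pow I k)); first exact: ideal_pow0.
    by move=> a b; apply: ideal_powD.
  move=> i _; have /subnKC {1}<- : (i <= k)%N by rewrite -ltnS.
  exact: ideal_powM.
Qed.
HB.instance Definition _ :=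
  GRing.isSubringClosed.Build {poly S} rees_pred rees_subring_closed.

Record rees := Rees { rees_val :> {poly S}; _ : rees_val \in rees_pred }.
HB.instance Definition _ := [isSub for rees_val].
HB.instance Definition _ := [Choice of rees by <:].
HB.instance Definition _ := [SubChoice_isSubComNzRing of rees by <:].

Lemma rees_coef (p : rees) k : ideal_pow I k (rees_val p)`_k.
Proof. by case: p => p /= /asboolP. Qed.

(* The sum of the (m I^k) t^k, an ideal of the Rees algebra. *)
Definition fiber_ideal : {pred rees} :=
  fun p => `[< forall k, ideal_mul max_ideal (ideal_pow I k) (rees_val p)`_k >].

Lemma fiber_ideal_closed : idealr_closed fiber_ideal.
Proof.
split.
- apply/asboolP => k; rewrite -[rees_val _]/(val _) raddf0 coef0.
  exact: ideal_mul0.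
- apply/asboolP => /(_ 0%N).
  rewrite -[rees_val _]/(val _) rmorph1 coef1 /= => -[u hu].
  move=> /(congr1 (mcoeff 0%MM)); rewrite rmorph1 raddf_sum big_seq big1.
    by apply/eqP; rewrite oner_eq0.
  move=> ab /hu[/max_ideal_coef0 h _].
  by rewrite -[X in X = _]/(mcoeff 0%MM (ab.1 * ab.2))
    (rmorphM (mcoeff 0%MM)) /= h mul0r.
- move=> a p q /asboolP hp /asboolP hq; apply/asboolP => k.
  have -> : rees_val (a * p + q) = rees_val a * rees_val p + rees_val q by [].
  rewrite coefD; apply: ideal_mulD (hq k); rewrite coefM.
  apply: (big_ind (ideal_mul max_ideal (ideal_pow I k))).
  + exact: ideal_mul0.
  + by move=> b c; apply: ideal_mulD.
  move=> i _; have /subnKC {1}<- : (i <= k)%N by rewrite -ltnS.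
  by apply: ideal_mul_powM => //; apply: rees_coef.
Qed.
HB.instance Definition _ :=
  isIdealr.Build rees fiber_ideal fiber_ideal_closed.

(* The direct sum of the I^k / m I^k, as the quotient of the direct sum of the
   I^k by the direct sum of the m I^k. *)
Definition fiber_cone : comNzRingType := {ideal_quot fiber_ideal}.

(* The classes of the elements of the Rees algebra without t^0 term. *)
Definition fiber_max_ideal (z : fiber_cone) : Prop :=
  exists2 p : rees, (rees_val p)`_0 = 0
    & z = (\pi_({ideal_quot fiber_ideal}) p)%qT.

End FiberCone.

(* Generated by x^(a_i) y^(a_(m-i+1)), i = 1, ..., m; a symmetric ideal when
   a_1 > ... > a_m = 0, these monomials then being the minimal generators. *)
Definition symmetric_ideal (K : fieldType) (m : nat) (a : nat -> nat) :
    {mpoly K[2]} -> Prop :=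
  ideal_gen [seq 'X_ord0 ^+ a i * 'X_ord_max ^+ a (m - i + 1)%N
            | i <- iota 1%N m].

Definition exponents (m i : nat) : nat :=
  (if i == 1 then 5 * m
   else if i <= m - 2 then 4 * m - (i - 2)
   else if i == m - 1 then m
   else 0)%N.

(* Main.v *)
Require Import Defs.
From mathcomp Require Import all_boot all_order all_algebra.
From mathcomp Require Import boolp.
From mathcomp Require Import mpoly.
From mathcomp Require Import zify.

(** Depth 0 means that a single nonzero element of F(I) is killed by the whole
    graded maximal ideal, since then every element of that ideal is a zero
    divisor.  The element is the class, in degree 1, of the third generator

      u_3 = x^(4m-1) y^(3m+4).

    Writing u_i = x^(a_i) y^(b_i) with b_i = a_(m-i+1), the generators are

      u_1 = x^(5m),       u_2 = x^(4m) y^m,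
      u_i = x^(4m+2-i) y^(3m+1+i)  for 3 <= i <= m-2,
      u_(m-1) = x^m y^(4m),        u_m = y^(5m).

    The outer four all have degree 5m, whereas the middle ones have the larger
    degree 7m+3.  A product u_3 u_i is therefore so large that it is a proper
    multiple of a product of two outer generators:

      u_2 u_2         divides  u_3 u_1,
      u_1 u_(m-1)     divides  u_3 u_i  for 2 <= i <= m-2,
      u_2 u_m         divides  u_3 u_(m-1),
      u_(m-1) u_(m-1) divides  u_3 u_m,

    each time with a strictly smaller exponent of x.  So u_3 u_i lies in m I^2
    for all i (exponents3_mul, monomial_in_max_pow2), and u_3 kills the graded
    maximal ideal.  On the other hand the class of u_3 is nonzero, because u_3
    is a minimal generator and hence not in m I (exponents3_minimal,
    minimal_generator_notin_max_mul).  The passage from these two facts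
    about ideals to the depth is depth_fiber_cone_eq0. *)

Set Implicit Arguments.
Unset Strict Implicit.
Unset Printing Implicit Defensive.

Import GRing.Theory.
Local Open Scope ring_scope.

(** * Ideals and depth zero *)

Section Ideals.
Variable R : comNzRingType.
Implicit Types (I J : R -> Prop) (s : seq R).

Lemma ideal_gen_nil x : ideal_gen [::] x <-> x = 0 :> R.
Proof.
by split=> [[c]|->]; [rewrite big_ord0 | exists (fun=> 0); rewrite big_ord0].
Qed.

Lemma mem_ideal_gen s x : x \in s -> ideal_gen s x.
Proof.
move=> xs; have lt_is : (index x s < size s)%N by rewrite index_mem.
exists (fun i => (i == Ordinal lt_is)%:R).
rewrite (bigD1 (Ordinal lt_is)) //= eqxx mul1r nth_index // big1 ?addr0 //.
by move=> i /negPf ->; rewrite mul0r.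
Qed.

Lemma ideal_genZ s r x : ideal_gen s x -> ideal_gen s (r * x).
Proof.
move=> [c ->]; exists (fun i => r * c i).
by rewrite mulr_sumr; apply: eq_bigr => i _; rewrite mulrA.
Qed.

Lemma ideal_genD s x y : ideal_gen s x -> ideal_gen s y -> ideal_gen s (x + y).
Proof.
move=> [c ->] [d ->]; exists (fun i => c i + d i).
by rewrite -big_split; apply: eq_bigr => i _; rewrite mulrDl.
Qed.

Lemma ideal_pow_gen1 s x : ideal_pow (ideal_gen s) 1 x <-> ideal_gen s x.
Proof.
split=> [[u hu ->]|sx].
  rewrite big_seq; apply: (big_ind (ideal_gen s)) => [|y z|ab /hu[sa _]].
  - by exists (fun=> 0); rewrite big1 // => i _; rewrite mul0r.
  - exact: ideal_genD.
  - by rewrite mulrC; apply: ideal_genZ.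
exists [:: (x, 1)]; last by rewrite big_seq1 mulr1.
by move=> ab /[!inE] /eqP->.
Qed.

Lemma ideal_mulM I J x y : I x -> J y -> ideal_mul I J (x * y).
Proof.
move=> Ix Jy; exists [:: (x, y)]; last by rewrite big_seq1.
by move=> ab /[!inE] /eqP->.
Qed.

(** The first term z of a regular sequence in J would be a nonzerodivisor,
    against z * w = 0; only the empty sequence is left. *)
Lemma has_depth0_of_annihilated J (w : R) :
  w != 0 -> (forall z, J z -> z * w = 0) -> has_depth J 0.
Proof.
move=> w0 Jw; split.
  exists [::]; split=> //; split=> // /ideal_gen_nil/eqP.
  by rewrite oner_eq0.
case=> // z s [reg _] sJ; case/eqP: w0; apply/ideal_gen_nil.
apply: (reg 0%N) => //=; apply/ideal_gen_nil.
by apply: Jw; apply: sJ; rewrite mem_head.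
Qed.

End Ideals.

(** * Socle elements of the fiber cone *)

Section FiberCone.
Variables (K : fieldType) (I : {mpoly K[2]} -> Prop).
Local Notation mI k := (ideal_mul (@max_ideal K) (ideal_pow I k)).
Local Notation cls := (\pi_({ideal_quot (fiber_ideal (I := I))}))%qT.

Lemma fiber_class_eq0 (p : rees I) :
  (cls p == 0) = (p \in fiber_ideal (I := I)).
Proof.
by rewrite -[X in _ == X](rmorph0 cls) -Quotient.idealrBE subr0.
Qed.

Lemma monomial_in_rees d w : ideal_pow I d w -> w *: 'X^d \in rees_pred I.
Proof.
move=> Iw; apply/asboolP => k; rewrite coefZ coefXn.
by case: eqP => [->|_]; rewrite ?mulr1 ?mulr0 //; apply: ideal_pow0.
Qed.

(** The three hypotheses say that w t^d represents a nonzero element of the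
    degree d part of F(I) that is killed by F(I)_1.  It is then killed by
    every homogeneous part of positive degree, as I^(j+1) = I * I^j. *)
Lemma depth_fiber_cone_eq0 d w :
    ideal_pow I d w -> ~ mI d w -> (forall a, I a -> mI d.+1 (w * a)) ->
  has_depth (@fiber_max_ideal K I) 0.
Proof.
move=> Iw mIw socw.
pose wt : rees I := Rees (monomial_in_rees Iw).
apply: (@has_depth0_of_annihilated _ _ (cls wt)).
  rewrite fiber_class_eq0; apply/negP => /asboolP/(_ d) /=.
  by rewrite coefZ coefXn eqxx mulr1.
move=> _ [p p0 ->]; rewrite -rmorphM.
apply/eqP; rewrite fiber_class_eq0; apply/asboolP => k.
have -> : rees_val (p * wt) = rees_val p * (w *: 'X^d) by [].
rewrite -scalerAr coefZ coefMXn.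
case: ltnP => [_|le_dk]; first by rewrite mulr0; apply: ideal_mul0.
(* The coefficient of t^k in p * wt is p_(k-d) * w.  For k = d it vanishes by
   p0; for k - d = j + 1, each term of p_(k-d) is in I * I^j, and its factor
   from I is absorbed by w. *)
have := rees_coef p (k - d); have := p0.
case def_j: (k - d)%N => [|j].
  by move=> -> _; rewrite mulr0; apply: ideal_mul0.
move=> _ [u hu ->]; rewrite mulr_sumr big_seq.
apply: (big_ind (mI k)); [exact: ideal_mul0 | exact: ideal_mulD |].
move=> ab /hu[Ia Ib]; rewrite mulrA mulrC.
have -> : k = (j + d.+1)%N by lia.
by apply: ideal_mul_powM => //; apply: socw.
Qed.

End FiberCone.

(** * Monomials in two variables *)

Section Monomials.
Variable K : fieldType.

Lemma mcoeffM_eq0 (p q : {mpoly K[2]}) (e : 'X_{1..2}) :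
  (forall k l, e = (k + l)%MM -> p@_k * q@_l = 0) -> (p * q)@_e = 0.
Proof. by move=> pq0; rewrite mcoeffM big1 // => k /eqP; apply: pq0. Qed.

(** Minimality of e forces every element of the monomial ideal to have zero
    coefficients at the proper divisors of X^e.  So X^e could only appear in a
    product a * b with a in m and b in the ideal through the constant
    coefficient of a, which is 0. *)
Lemma minimal_generator_notin_max_mul (s : seq 'X_{1..2}) (e : 'X_{1..2}) :
    (forall n, n \in s -> (n <= e)%MM -> n = e) ->
  ~ ideal_mul (@max_ideal K) (ideal_gen [seq 'X_[n] | n <- s]) 'X_[e].
Proof.
move=> s_min.
have gen0 b : ideal_gen [seq 'X_[n] | n <- s] b ->
    forall e', (e' <= e)%MM -> e' != e -> (b : {mpoly K[2]})@_e' = 0.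
  move=> [c ->] e' le_e' ne_e'; rewrite raddf_sum big1 //= => i _.
  have /mapP[n s_n ->] := mem_nth 0 (ltn_ord i).
  apply: mcoeffM_eq0 => k l def_e'; rewrite mcoeffX.
  case: eqP => [def_n|]; last by rewrite mulr0.
  case/eqP: ne_e'; have le_ne' : (n <= e')%MM.
    by rewrite def_e' def_n lem_addl.
  have def_e := s_min n s_n (lepm_trans le_ne' le_e').
  apply/mnmP => j; apply/eqP; rewrite eqn_leq (mnm_lepP le_e').
  by rewrite -{1}def_e (mnm_lepP le_ne').
move=> [u hu] /(congr1 (mcoeff e)) /eqP.
rewrite mcoeffX eqxx raddf_sum big_seq big1 ?oner_eq0 //= => ab /hu[ma sb].
apply: mcoeffM_eq0 => k l def_e.
have [l_e|ne_l] := eqVneq l e; last first.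
  by rewrite [X in _ * X]gen0 ?mulr0 // def_e lem_addl.
suff -> : k = 0%MM by rewrite max_ideal_coef0 // mul0r.
by apply: (@addmI _ e); rewrite addm0 {2}def_e addmC l_e.
Qed.

Definition bidegree (a b : nat) : 'X_{1..2} :=
  (U_(ord0) *+ a + U_(ord_max) *+ b)%MM.

Lemma bidegreeE a b :
  'X_ord0 ^+ a * 'X_ord_max ^+ b = 'X_[bidegree a b] :> {mpoly K[2]}.
Proof. by rewrite mpolyXD !mpolyXn. Qed.

Lemma bidegreeD a b a' b' :
  (bidegree a b + bidegree a' b' = bidegree (a + a') (b + b'))%MM.
Proof. by apply/mnmP => i; rewrite !(mnmDE, mulmnE, mnm1E); lia. Qed.

Lemma le_bidegree a b a' b' :
  (bidegree a b <= bidegree a' b')%MM = (a <= a')%N && (b <= b')%N.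
Proof.
apply/mnm_lepP/andP => [le_n|[le_a le_b] i].
  have := le_n ord0; have := le_n ord_max.
  by rewrite !(mnmDE, mulmnE, mnm1E) /= !(mul1n, mul0n, add0n, addn0).
by rewrite !(mnmDE, mulmnE, mnm1E) leq_add // leq_mul.
Qed.

(** The strict inequality in the exponent of x leaves a spare factor x, which
    is the element of the maximal ideal. *)
Lemma monomial_in_max_pow2 (I : {mpoly K[2]} -> Prop) a b a' b' c d :
    I 'X_[bidegree a b] -> I 'X_[bidegree a' b'] ->
    (a + a' < c)%N -> (b + b' <= d)%N ->
  ideal_mul (@max_ideal K) (ideal_pow I 2) 'X_[bidegree c d].
Proof.
move=> Iab Iab' lt_c le_d.
have -> : bidegree c d = (bidegree 1 0 +
    (bidegree a b + (bidegree a' b' +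
      bidegree (c - (a + a' + 1)) (d - (b + b')))))%MM.
  by rewrite !bidegreeD; congr bidegree; lia.
rewrite mpolyXD; apply: ideal_mulM.
  apply: mem_ideal_gen; rewrite -bidegreeE expr1 expr0 mulr1.
  exact: mem_head.
rewrite mpolyXD; apply: ideal_mulM => //.
by rewrite mpolyXD; apply: ideal_mulM.
Qed.

Definition bidegrees (m : nat) (a : nat -> nat) : seq 'X_{1..2} :=
  [seq bidegree (a i) (a (m - i + 1)%N) | i <- iota 1 m].

Lemma symmetric_idealE m a : @symmetric_ideal K m a =
  ideal_gen [seq 'X_[n] | n <- bidegrees m a].
Proof.
rewrite /symmetric_ideal /bidegrees -map_comp; congr ideal_gen.
by apply: eq_map => i; rewrite /= bidegreeE.
Qed.

End Monomials.

(** * The given exponent sequence *)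

Section Exponents.
Variable m : nat.
Hypothesis m_ge5 : (5 <= m)%N.
Local Notation a := (exponents m).
Local Notation b i := (exponents m (m - i + 1)).

Lemma exponents_mid i : (2 <= i <= m - 2)%N -> a i = (4 * m - (i - 2))%N.
Proof. by rewrite /exponents; case: eqP => ?; [lia | case: ifP => ?; lia]. Qed.

Lemma exponents_penultimate : a (m - 1) = m.
Proof.
rewrite /exponents eqxx; case: eqP => ?; first lia.
by case: ifP => ?; lia.
Qed.

Lemma exponents_last : a m = 0%N.
Proof.
rewrite /exponents; case: eqP => ?; first lia.
by case: ifP => ?; [lia | case: eqP => ?; lia].
Qed.

Lemma exponents_cases i : (0 < i <= m)%N ->
  (i = 1 /\ a i = 5 * m /\ b i = 0 \/
   i = 2 /\ a i = 4 * m /\ b i = m \/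
   3 <= i <= m - 2 /\ a i = 4 * m + 2 - i /\ b i = 3 * m + i + 1 \/
   i = m - 1 /\ a i = m /\ b i = 4 * m \/
   i = m /\ a i = 0 /\ b i = 5 * m)%N.
Proof.
move=> i_range.
have [->|i1] := eqVneq i 1%N.
  have -> : (m - 1 + 1 = m)%N by lia.
  by rewrite exponents_last; left.
have [->|i2] := eqVneq i 2%N.
  have -> : (m - 2 + 1 = m - 1)%N by lia.
  by right; left; rewrite exponents_penultimate exponents_mid; lia.
have [->|im] := eqVneq i m.
  by rewrite exponents_last subnn; do 4 right.
have [->|im1] := eqVneq i (m - 1)%N.
  have -> : (m - (m - 1) + 1 = 2)%N by lia.
  by do 3 right; left; rewrite exponents_penultimate exponents_mid; lia.
by do 2 right; left; rewrite !exponents_mid; lia.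
Qed.

(** In the range 3 <= i <= m - 2 the two exponents of u_i vary in opposite
    directions, and each outer generator exceeds u_3 in one variable; for
    u_(m-1) this is 4m > 3m + 4, where m >= 5 enters. *)
Lemma exponents3_minimal i : (0 < i <= m)%N ->
  (a i <= a 3)%N -> (b i <= b 3)%N -> i = 3%N.
Proof.
move=> i_range.
by have := @exponents_cases 3; have := exponents_cases i_range; lia.
Qed.

Lemma exponents3_mul i : (0 < i <= m)%N ->
  exists j k, [/\ (0 < j <= m)%N, (0 < k <= m)%N,
    (a j + a k < a 3 + a i)%N & (b j + b k <= b 3 + b i)%N].
Proof.
move=> i_range; have := exponents_cases i_range.
have := @exponents_cases 1; have := @exponents_cases 2.
have := @exponents_cases 3; have := @exponents_cases m.
have := @exponents_cases (m - 1) => Hm1 Hm H3 H2 H1.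
case=> [[-> _]|[[-> _]|[[i_mid [-> ->]]|[[-> _]|[-> _]]]]].
- by exists 2%N, 2%N; split; lia.
- by exists 1%N, (m - 1)%N; split; lia.
- by exists 1%N, (m - 1)%N; split; lia.
- by exists 2%N, m; split; lia.
- by exists (m - 1)%N, (m - 1)%N; split; lia.
Qed.

End Exponents.

Local Close Scope ring_scope.

Theorem proposition3p1 (K : fieldType) (m : nat) (hm : (5 <= m)%N) :
  has_depth (@fiber_max_ideal K (@symmetric_ideal K m (exponents m))) 0.
Proof.
rewrite symmetric_idealE; set gens := bidegrees m (exponents m).
pose n i := bidegree (exponents m i) (exponents m (m - i + 1)).
pose I := @ideal_gen {mpoly K[2]} [seq 'X_[e] | e <- gens].
have In i : (0 < i <= m)%N -> I 'X_[n i].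
  move=> i_range; apply: mem_ideal_gen; apply/map_f/mapP.
  by exists i; rewrite // mem_iota; lia.
apply: (@depth_fiber_cone_eq0 _ I 1 'X_[n 3]).
- by apply/ideal_pow_gen1/In; lia.
- move=> [u hu def_u]; apply: (@minimal_generator_notin_max_mul K gens (n 3)).
    move=> _ /mapP[i i_range ->]; rewrite le_bidegree => /andP[le_a le_b].
    rewrite mem_iota in i_range.
    by rewrite [i](exponents3_minimal hm) //; lia.
  by exists u => // ab /hu[max_a /ideal_pow_gen1].
move=> f [c ->]; rewrite mulr_sumr.
apply: (big_ind (ideal_mul (@max_ideal K) (ideal_pow I 2))) => [|? ?|i _].
- exact: ideal_mul0.
- exact: ideal_mulD.
rewrite mulrCA; apply: ideal_mulZ; first by move=> ? ?; apply: ideal_powZ.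
have /mapP[_ /mapP[j j_range ->] ->] := mem_nth 0%R (ltn_ord i).
rewrite mem_iota in j_range; rewrite -mpolyXD bidegreeD.
have [|k [l [k_range l_range lt_a le_b]]] := @exponents3_mul m hm j; first lia.
exact: monomial_in_max_pow2 (In k k_range) (In l l_range) lt_a le_b.
Qed.
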